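(* Let $K$ be a field, $d\in\mathbb{N}$, $R=K[x_1,\ldots,x_d]$ and $\mathfrak{m}=(x_1,\ldots,x_d)$. Let $I\subseteq J$ be monomial ideals in $R$. Then there is a natural map $u:(I:\mathfrak{m})/I\to(J:\mathfrak{m})/J$, given by $u(f+I)=f+J$, such that (a) $\partial\mathrm{oc}(I)\subseteq\partial\mathrm{oc}(J)$ if and only if $u$ is injective, and (b) $\partial\mathrm{oc}(J)\subseteq\partial\mathrm{oc}(I)$ if and only if $u$ is surjective.
   Context: For a monomial ideal $I$ of $R$, the docle $\partial\mathrm{oc}(I)$ is the set of monomials in $(I:\mathfrak{m})\setminus I$; i.e. the monomials $a\notin I$ with $x_ia\in I$ for all $i$. *)

(* Defs.v *)
From HB Require Import structures.
From mathcomp Require Import all_boot all_algebra.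
From mathcomp Require Import boolp.
From mathcomp Require Import mpoly.

Set Implicit Arguments.
Unset Strict Implicit.
Unset Printing Implicit Defensive.

Import GRing.Theory.
Local Open Scope ring_scope.
Local Open Scope quotient_scope.

(* Ideals, possibly equal to R, are the R-submodules of the regular module
   R^o (the structure idealr of ring_quotient only covers proper ideals).
   Membership is boolean, which loses no generality classically. *)
Notation ideal R := (submodClosed R^o) (only parsing).

Section Ideals.
Variable R : comNzRingType.

Definition ideal_gen (S : R -> Prop) : {pred R^o} :=
  fun f => `[< exists s : seq (R * R),
                 (forall p, p \in s -> S p.2) /\ f = \sum_(p <- s) p.1 * p.2 >].

Fact ideal_gen_submod_closed S : submod_closed (ideal_gen S).
Proof.
split=> [|a f g /asboolP[s [sS ->]] /asboolP[t [tS ->]]]; apply/asboolP.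
  by exists [::]; rewrite big_nil.
exists ([seq (a * p.1, p.2) | p <- s] ++ t); split=> [p|].
  by rewrite mem_cat => /orP[/mapP[q /sS Sq ->]|/tS].
rewrite big_cat big_map; congr (_ + _); rewrite -[LHS]/(a * _) mulr_sumr.
by apply: eq_bigr => p _; rewrite mulrA.
Qed.

HB.instance Definition _ S :=
  GRing.isSubmodClosed.Build R R^o (ideal_gen S) (ideal_gen_submod_closed S).

Definition colon (I A : ideal R) : {pred R^o} :=
  fun f => `[< forall g : R, g \in A -> (f : R) * g \in I >].

Fact colon_submod_closed I A : submod_closed (colon I A).
Proof.
split=> [|a f g /asboolP fI /asboolP gI]; apply/asboolP => h Ah.
  by rewrite mul0r; exact: rpred0.
rewrite mulrDl -mulrA; apply: (rpredD (V := R^o)); last exact: gI.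
by apply: (rpredZ (V := R^o)); exact: fI.
Qed.

HB.instance Definition _ I A :=
  GRing.isSubmodClosed.Build R R^o (colon I A) (colon_submod_closed I A).

End Ideals.

Section QuotientModule.
Variables (R : pzRingType) (V : lmodType R).

Definition submod (M : submodClosed V) : Type := {x : V | x \in M}.

HB.instance Definition _ M := SubType.on (submod M).
HB.instance Definition _ M := Choice.on (submod M).
HB.instance Definition _ M := [SubChoice_isSubLmodule of submod M by <:].

Definition submod_trace (M N : submodClosed V) : {pred submod M} :=
  fun x => val x \in N.

Fact submod_trace_closed M N : submod_closed (@submod_trace M N).
Proof.
split=> [|a x y xN yN]; rewrite -topredE /= /submod_trace.
  by rewrite raddf0 rpred0.
rewrite raddfD; apply: rpredD => //.
by change (val (a *: x) \in N); rewrite linearZ; apply: rpredZ.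
Qed.

HB.instance Definition _ M N :=
  GRing.isSubmodClosed.Build R (submod M) (@submod_trace M N)
    (@submod_trace_closed M N).

(* The quotient module M / N; it is meant for N included in M (in general it
   is M / (M :&: N)). *)
Definition quotmod (M N : submodClosed V) : Type :=
  Quotient.quot (@submod_trace M N).

Section Structure.
Variables M N : submodClosed V.
Local Notation Q := (quotmod M N).

HB.instance Definition _ := ZmodQuotient.on Q.

Fact quotmod_scale_proj a (x : submod M) :
  \pi_Q (a *: repr (\pi_Q x)) = \pi_Q (a *: x).
Proof.
apply/eqP; rewrite -Quotient.idealrBE -scalerBr; apply: rpredZ.
by rewrite Quotient.idealrBE reprK.
Qed.

Definition quotmod_scale (a : R) (x : Q) : Q := \pi_Q (a *: repr x).

Fact quotmod_scalerA a b x :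
  quotmod_scale a (quotmod_scale b x) = quotmod_scale (a * b) x.
Proof. by rewrite /quotmod_scale quotmod_scale_proj scalerA. Qed.

Fact quotmod_scale1r : left_id 1 quotmod_scale.
Proof. by move=> x; rewrite /quotmod_scale scale1r reprK. Qed.

Fact quotmod_scalerDr : right_distributive quotmod_scale +%R.
Proof.
move=> a x y; rewrite /quotmod_scale -[x in LHS]reprK -[y in LHS]reprK.
by rewrite -pi_addr quotmod_scale_proj scalerDr pi_addr.
Qed.

Fact quotmod_scalerDl x : {morph quotmod_scale^~ x : a b / a + b}.
Proof. by move=> a b; rewrite /quotmod_scale scalerDl pi_addr. Qed.

HB.instance Definition _ :=
  GRing.Zmodule_isLmodule.Build R Q
    quotmod_scalerA quotmod_scale1r quotmod_scalerDr quotmod_scalerDl.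

Definition quotmod_class (x : submod M) : Q := \pi_Q x.

Fact quotmod_class_is_linear : linear quotmod_class.
Proof.
move=> a x y; rewrite /quotmod_class pi_addr; congr (_ + _).
by rewrite -quotmod_scale_proj.
Qed.

HB.instance Definition _ :=
  GRing.isLinear.Build R (submod M) Q *:%R quotmod_class quotmod_class_is_linear.

End Structure.
End QuotientModule.

Section MonomialIdeals.
Variables (K : fieldType) (d : nat).
Local Notation P := {mpoly K[d]}.

Definition is_monomial (f : P) : Prop := exists m : 'X_{1..d}, f = 'X_[m].

Definition monomial_ideal (I : ideal P) : Prop :=
  exists S : P -> Prop,
    (forall f, S f -> is_monomial f) /\ (I : {pred P}) =i ideal_gen S.

Definition irrelevant_ideal : ideal P :=
  ideal_gen (fun f : P => exists i : 'I_d, f = 'X_i).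

Definition docle (I : ideal P) : {pred P} :=
  fun f => [&& `[< is_monomial f >], f \in colon I irrelevant_ideal
             & f \notin I].

End MonomialIdeals.

(* Main.v *)
(* A polynomial lies in I, or in I : m, exactly when every monomial of its
   support does. So the kernel ((I : m) /\ J) / I of u is spanned by the classes
   of the elements of docle I that lie in J, and its cokernel
   (J : m) / ((I : m) + J) by those of the elements of docle J outside I : m. *)
Require Import Defs.
From HB Require Import structures.
From mathcomp Require Import all_boot all_algebra.
From mathcomp Require Import boolp.
From mathcomp Require Import mpoly.
Import GRing.Theory.
Local Open Scope ring_scope.

Section QuotientMap.
Set Implicit Arguments.
Unset Strict Implicit.
Variables (R : pzRingType) (V : lmodType R).

Lemma eq_quotmod_class (M N : submodClosed V) (x y : submod M) :
  (quotmod_class N x = quotmod_class N y) <-> (val x - val y \in N).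
Proof.
have <- : val (x - y) = val x - val y by exact: raddfB.
have -> : (val (x - y) \in N) = (x - y \in submod_trace N) by [].
by rewrite Quotient.idealrBE; split=> /eqP.
Qed.

Lemma quotmod_classP (M N : submodClosed V) (q : quotmod M N) :
  exists x, q = quotmod_class N x.
Proof. by exists (repr q); rewrite /quotmod_class reprK. Qed.

Variables M N M' N' : submodClosed V.
Hypotheses (sM : {subset M <= M'}) (sN : {subset N <= N'}).

Definition submod_incl (x : submod M) : submod M' :=
  Sub (val x) (sM (valP x)).

(** The value is computed on the chosen representative [repr q]; [quotmod_map_class] shows that any
    other would do. *)
Definition quotmod_map (q : quotmod M N) : quotmod M' N' :=
  quotmod_class N' (submod_incl (repr q)).

(** Two representatives of a class differ by an element of [N], hence of [N']. *)
Lemma quotmod_map_class x :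
  quotmod_map (quotmod_class N x) = quotmod_class N' (submod_incl x).
Proof.
have /eq_quotmod_class/sN xN :
    quotmod_class N (repr (quotmod_class N x)) = quotmod_class N x.
  exact: (reprK (quotmod_class N x)).
exact: (eq_quotmod_class _ _ _).2.
Qed.

Fact quotmod_map_is_linear : linear quotmod_map.
Proof.
move=> a q r; have [x ->] := quotmod_classP q; have [y ->] := quotmod_classP r.
rewrite -linearP !quotmod_map_class -linearP; congr quotmod_class.
by apply: val_inj; rewrite [RHS]linearP [LHS]linearP.
Qed.

Definition quotmod_linear : {linear quotmod M N -> quotmod M' N'} :=
  HB.pack quotmod_map
    (GRing.isLinear.Build R (quotmod M N) (quotmod M' N') *:%R quotmod_map
      quotmod_map_is_linear).

End QuotientMap.

Section MonomialSupport.
Set Implicit Arguments.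
Unset Strict Implicit.
Variables (K : fieldType) (d : nat).
Local Notation P := {mpoly K[d]}.

(** The converse implication holds for every ideal ([mem_ideal_support]). This form of monomiality
    passes to colon ideals without exhibiting generators. *)
Definition support_closed (N : ideal P) : Prop :=
  forall (f : P) m, f \in N -> m \in msupp f -> ('X_[m] : P) \in N.

Lemma ideal_mull (N : ideal P) (f g : P) : g \in N -> f * g \in N.
Proof. by move=> gN; apply: (rpredZ (V := P^o)). Qed.

Lemma mem_ideal_support (N : ideal P) (f : P) :
  (forall m, m \in msupp f -> ('X_[m] : P) \in N) -> f \in N.
Proof.
move=> fN; rewrite (mpolyE f) big_seq; apply: (rpred_sum (V := P^o)) => m mf.
by rewrite -mul_mpolyC; apply/ideal_mull/fN.
Qed.

(** A monomial with nonzero coefficient in a combination of generators has one in some summand [p.1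
    * 'X_[k]], so it is a multiple of the generator ['X_[k]]. *)
Lemma monomial_ideal_support_closed (N : ideal P) :
  monomial_ideal N -> support_closed N.
Proof.
case=> S [monS eqN] f m; rewrite eqN => /asboolP[s [sS ->]].
rewrite mcoeff_msupp raddf_sum /= => /eqP sum_neq0.
have [p ps p_neq0] : exists2 p, p \in s & (p.1 * p.2)@_m != 0.
  apply: contrapT => no; case: sum_neq0; rewrite big_seq big1 // => p ps.
  by apply/eqP; apply: contrapT => /negP pm; apply: no; exists p.
have [k p2k] := monS _ (sS _ ps).
have : m \in msupp (p.1 * 'X_[k]) by rewrite -p2k mcoeff_msupp.
rewrite (perm_mem (msuppMX _ _)) => /mapP[l _ ->].
rewrite addmC mpolyXD; apply: ideal_mull; rewrite eqN -p2k; apply/asboolP.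
exists [:: (1, p.2)]; rewrite big_seq1 mul1r; split=> // q.
by rewrite inE => /eqP ->; exact: (sS _ ps).
Qed.

(** By linearity it is enough to test multiplication on the generating variables. *)
Lemma mem_colon_irrelevant (N : ideal P) (f : P) :
  f \in colon N (irrelevant_ideal K d) <-> forall i : 'I_d, f * 'X_i \in N.
Proof.
split=> [/asboolP fN i|fN].
  apply: fN; apply/asboolP; exists [:: (1, 'X_i)]; rewrite big_seq1 mul1r.
  by split=> // q; rewrite inE => /eqP ->; exists i.
apply/asboolP => _ /asboolP[s [sX ->]]; rewrite mulr_sumr big_seq.
apply: (rpred_sum (V := P^o)) => p /sX[i ->].
by rewrite mulrCA; apply/ideal_mull/fN.
Qed.

Lemma colon_irrelevant_support_closed (N : ideal P) :
  support_closed N -> support_closed (colon N (irrelevant_ideal K d)).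
Proof.
move=> clN f m /mem_colon_irrelevant fN mf; apply/mem_colon_irrelevant => i.
(* Multiplication by ['X_i] shifts exponents without cancellation, so the shift of [m] lies in the
   support of [f * 'X_i]. *)
rewrite -mpolyXD; apply: (clN _ _ (fN i)).
by rewrite mcoeff_msupp addmC mcoeffMX -mcoeff_msupp.
Qed.

Lemma docleX (N : ideal P) m :
  ('X_[m] \in docle N)
    = ('X_[m] \in colon N (irrelevant_ideal K d)) && ('X_[m] \notin N).
Proof.
rewrite -topredE /= /docle; case: asboolP => //= -[]; by exists m.
Qed.

Lemma docleP (N : ideal P) f : f \in docle N -> exists m, f = 'X_[m].
Proof. by case/and3P=> /asboolP. Qed.

Lemma colonS (I J A : ideal P) :
  {subset I <= J} -> {subset colon I A <= colon J A}.
Proof. by move=> sIJ f /asboolP fI; apply/asboolP => g /fI /sIJ. Qed.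

End MonomialSupport.

Theorem proposition5p1 (K : fieldType) (d : nat) (I J : ideal {mpoly K[d]})
    (monI : monomial_ideal I) (monJ : monomial_ideal J)
    (sIJ : {subset I <= J}) :
  let m := irrelevant_ideal K d in
  exists u : {linear quotmod (colon I m) I -> quotmod (colon J m) J},
    (forall (f : {mpoly K[d]}) (fI : f \in colon I m),
       exists fJ : f \in colon J m,
         u (quotmod_class I (Sub f fI)) = quotmod_class J (Sub f fJ))
    /\ ({subset docle I <= docle J} <-> injective u)
    /\ ({subset docle J <= docle I} <-> (forall y, exists x, u x = y)).
Proof.
move=> m.
have sC := @colonS _ _ _ _ m sIJ.
have suppI := monomial_ideal_support_closed monI.
have suppJ := monomial_ideal_support_closed monJ.
have suppIm := colon_irrelevant_support_closed suppI.
have suppJm := colon_irrelevant_support_closed suppJ.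
pose u : {linear quotmod (colon I m) I -> quotmod (colon J m) J} :=
  quotmod_linear sC sIJ.
have uE x : u (quotmod_class I x) = quotmod_class J (submod_incl sC x).
  exact: quotmod_map_class.
exists u; split; [|split; split].
- move=> f fI; exists (sC _ fI); rewrite uE; congr quotmod_class.
  exact: val_inj.
- move=> sdoc q r; have [x ->] := quotmod_classP q.
  have [y ->] := quotmod_classP r.
  rewrite !uE => /eq_quotmod_class xyJ; apply: (eq_quotmod_class _ _ _).2.
  have xyIm : val x - val y \in colon I m by exact: rpredB (valP x) (valP y).
  (* A monomial of [x - y] outside [I] would lie in [docle I], hence in [docle J], and so outside
     [J]; but [x - y] is in [J]. *)
  apply: mem_ideal_support => k kxy; apply: contraT => kI.
  have : 'X_[k] \in docle I by rewrite docleX kI (suppIm _ _ xyIm kxy).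
  by move/sdoc; rewrite docleX (suppJ _ _ xyJ kxy) andbF.
- move=> injU f fdoc; have [k fE] := docleP fdoc; move: fdoc.
  rewrite {f}fE !docleX => /andP[kIm kI]; rewrite sC //=.
  apply: contra kI => kJ.
  (* If ['X_[k]] were in [J], its class would have the same image as 0, and injectivity would put it
     in [I]. *)
  suff /injU/eq_quotmod_class :
      u (quotmod_class I (Sub 'X_[k] kIm)) = u (quotmod_class I 0).
    by rewrite /= subr0.
  rewrite !uE; apply: (eq_quotmod_class _ _ _).2.
  by rewrite /= subr0.
- move=> sdoc q; have [y ->] := quotmod_classP q.
  set f : {mpoly K[d]} := val y.
  (* The preimage is the part of [f] supported in [I : m]; the discarded terms will be shown to lie
     in [J]. *)
  pose g : {mpoly K[d]} :=
    \sum_(k <- msupp f | 'X_[k] \in colon I m) f@_k *: 'X_[k].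
  have gI : g \in colon I m.
    apply: (rpred_sum (V := {mpoly K[d]}^o)) => k kI.
    by rewrite -mul_mpolyC; apply: ideal_mull.
  exists (quotmod_class I (Sub g gI)); rewrite uE.
  apply: (eq_quotmod_class _ _ _).2.
  have -> : val (submod_incl sC (Sub g gI)) = g by [].
  have -> : g - f =
      -1 * \sum_(k <- msupp f | 'X_[k] \notin colon I m) f@_k *: 'X_[k].
    rewrite mulN1r {1}(mpolyE f) (bigID (fun k => 'X_[k] \in colon I m)) /=.
    by rewrite opprD addrA subrr sub0r.
  apply: ideal_mull; rewrite big_seq_cond.
  apply: (rpred_sum (V := {mpoly K[d]}^o)) => k /andP[kf kIm].
  (* A discarded monomial outside [J] would belong to [docle J], hence to [docle I], and so to
     [I : m]. *)
  rewrite -mul_mpolyC; apply: ideal_mull; apply: contraNT kIm => kJ.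
  have /sdoc : 'X_[k] \in docle J by rewrite docleX kJ (suppJm _ _ (valP y) kf).
  by rewrite docleX => /andP[].
- move=> surjU f fdoc; have [k fE] := docleP fdoc; move: fdoc.
  rewrite {f}fE !docleX => /andP[kJm kJ]; rewrite (contra (sIJ _) kJ) andbT.
  have [q] := surjU (quotmod_class J (Sub 'X_[k] kJm)).
  have [x ->] := quotmod_classP q.
  rewrite uE => /eq_quotmod_class /= xkJ.
  (* It suffices that [k] occurs in the preimage [x], which lies in [I : m]. Otherwise [x - 'X_[k]],
     an element of [J], has coefficient -1 at [k], which forces ['X_[k]] into [J]. *)
  apply: (suppIm _ _ (valP x)); apply: contraNT kJ => kx.
  apply: (suppJ _ _ xkJ).
  rewrite mcoeff_msupp mcoeffB mcoeffX eqxx.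
  move: kx; rewrite mcoeff_msupp negbK => /eqP ->.
  by rewrite sub0r oppr_eq0 oner_eq0.
Qed.
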